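(* Let $q\geq 5$ be a prime power and let $X\subset\mathbf{P}^3$ be an elliptic quadric over $\mathbf{F}_q$. The code $C_L(X,\mathcal{O}_X(3))$ has length $q^2+1$, dimension $16$ and minimum distance at least $\delta$, where $$\delta = q^2+1-\max\bigl(3q+3,\ \min(4q,\ q+1+4\lfloor 2\sqrt{q}\rfloor)\bigr).$$ That is, $$\delta=\begin{cases} q^2+1-4q & \text{if } q\leq 7,\\ q^2-q-4\lfloor 2\sqrt{q}\rfloor & \text{if } 8\leq q\leq 13,\\ q^2-2-3q & \text{if } q\geq 16.\end{cases}$$
   Context: An elliptic quadric over $\mathbf{F}_q$ is a smooth quadric surface $X\subset\mathbf{P}^3$ defined over $\mathbf{F}_q$ whose two rulings by lines are not defined over $\mathbf{F}_q$ but are exchanged by the Frobenius (equivalently, $X$ contains no line defined over $\mathbf{F}_q$); it has $q^2+1$ rational points. For a line bundle $\mathcal{L}$ on a smooth projective geometrically irreducible surface $X$ over $\mathbf{F}_q$ with rational points $X(\mathbf{F}_q)=\{P_1,\dots,P_n\}$ (all of them), the code $C_L(X,\mathcal{L})\subset \mathbf{F}_q^n$ is the image of the evaluation map $H^0(X,\mathcal{L})\to\bigoplus_i \mathcal{L}_{P_i}\simeq\mathbf{F}_q^n$, $f\mapsto (f_{P_1},\dots,f_{P_n})$, where a coordinate has been chosen on each fibre (different choices give codes isometric for the Hamming distance). For $m\ge 0$, $H^0(X,\mathcal{O}_X(m))$ is the space of restrictions to $X$ of homogeneous polynomials of degree $m$ in $4$ variables over $\mathbf{F}_q$. The minimum distance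 is with respect to the Hamming metric. *)

(* Defs.v *)
(* Mathematical Components, with multinomials for homogeneous polynomials. *)
From HB Require Import structures.
From mathcomp Require Import all_boot all_order all_algebra all_field.
From mathcomp Require Import mpoly.

Set Implicit Arguments.
Unset Strict Implicit.
Unset Printing Implicit Defensive.

Import Order.TTheory GRing.Theory Num.Theory.
Local Open Scope ring_scope.

(* Value of a form at a vector of homogeneous coordinates. *)
Definition form_eval (R : comNzRingType) (f : {mpoly R[4]}) (v : 'rV[R]_4) : R :=
  f.@[fun j => v 0 j].

(* A line of P^3 is a subspace of dimension 2 of K^4.  Here K is meant to be
   algebraically closed, hence infinite, so that containment can be tested on
   the K-points. *)
Definition line_on (K : fieldType) (f : {mpoly K[4]})
    (L : {vspace 'rV[K]_4}) : Prop :=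
  \dim L = 2 /\ (forall v : 'rV[K]_4, v \in L -> form_eval f v = 0).

Definition smooth_surface (K : fieldType) (f : {mpoly K[4]}) : Prop :=
  forall v : 'rV[K]_4, v != 0 -> form_eval f v = 0 ->
    exists i : 'I_4, form_eval (mderiv i f) v != 0.

(* A ruling is a family of lines on the surface such that every point of the
   surface lies on exactly one of them. *)
Definition ruling (K : fieldType) (f : {mpoly K[4]})
    (R : {vspace 'rV[K]_4} -> Prop) : Prop :=
  (forall L, R L -> line_on f L) /\
  (forall v : 'rV[K]_4, v != 0 -> form_eval f v = 0 ->
     exists! L, R L /\ v \in L).

Definition two_rulings (K : fieldType) (f : {mpoly K[4]})
    (R1 R2 : {vspace 'rV[K]_4} -> Prop) : Prop :=
  [/\ ruling f R1, ruling f R2,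
      forall L, line_on f L -> R1 L \/ R2 L
    & forall L, ~ (R1 L /\ R2 L)].

(* Image of a subspace of K^4 under the coordinatewise map x |-> x^q; that map
   is semilinear, so the image of a basis spans it. *)
Definition frobenius (K : fieldType) (q : nat)
    (L : {vspace 'rV[K]_4}) : {vspace 'rV[K]_4} :=
  <<[seq map_mx (fun x : K => (x ^+ q)%R) v | v <- vbasis L]>>%VS.

(* The quadric Q = 0 over F, where iota : F -> K is an algebraic closure. *)
Definition elliptic_quadric (F : finFieldType) (K : closedFieldType)
    (iota : {rmorphism F -> K}) (Q : {mpoly F[4]}) : Prop :=
  let QK := map_mpoly iota Q in
  [/\ Q \is 2.-homog, smooth_surface QK
    & exists R1 R2 : {vspace 'rV[K]_4} -> Prop,
      two_rulings QK R1 R2 /\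
      (forall L, (R1 L -> R2 (frobenius #|F| L)) /\
                 (R2 L -> R1 (frobenius #|F| L)))].

(* P lists the rational points of Q = 0, each exactly once, through chosen
   homogeneous coordinates. *)
Definition rational_points (F : finFieldType) (Q : {mpoly F[4]}) (n : nat)
    (P : 'I_n -> 'rV[F]_4) : Prop :=
  (forall i, P i != 0 /\ form_eval Q (P i) = 0) /\
  (forall v : 'rV[F]_4, v != 0 -> form_eval Q v = 0 ->
     exists! i, exists a : F, v = a *: P i).

(* Evaluation of forms of degree m at the points P i.  The representative P i
   identifies the fibre of O(m) at that point with F; the nonzero scalar c i
   accounts for an arbitrary choice of coordinate on the fibre. *)
Definition evaluation (F : finFieldType) (m n : nat)
    (P : 'I_n -> 'rV[F]_4) (c : 'I_n -> F) (f : dhomog 4 F m) : 'rV[F]_n :=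
  \row_i (c i * form_eval (mpoly_of_dhomog f) (P i)).

Lemma evaluation_is_linear (F : finFieldType) (m n : nat)
    (P : 'I_n -> 'rV[F]_4) (c : 'I_n -> F) : linear (@evaluation F m n P c).
Proof.
move=> a f g; apply/rowP=> i; rewrite !mxE /form_eval.
by rewrite -[mpoly_of_dhomog _]/(a *: mpoly_of_dhomog f + mpoly_of_dhomog g)
  mevalD mevalZ mulrDr mulrCA.
Qed.

HB.instance Definition _ (F : finFieldType) (m n : nat)
    (P : 'I_n -> 'rV[F]_4) (c : 'I_n -> F) :=
  GRing.isLinear.Build F (dhomog 4 F m) 'rV[F]_n *:%R (@evaluation F m n P c)
    (@evaluation_is_linear F m n P c).

(* The sections of O_X(m) are the restrictions to X of forms of degree m, so
   the code of O_X(m) is the image of the forms of degree m. *)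
Definition evaluation_code (F : finFieldType) (m n : nat)
    (P : 'I_n -> 'rV[F]_4) (c : 'I_n -> F) : {vspace 'rV[F]_n} :=
  limg (linfun (@evaluation F m n P c)).

Lemma evaluation_codeP (F : finFieldType) (m n : nat)
    (P : 'I_n -> 'rV[F]_4) (c : 'I_n -> F) (w : 'rV[F]_n) :
  w \in evaluation_code m P c <->
  exists2 f : {mpoly F[4]}, f \is m.-homog &
    w = \row_i (c i * form_eval f (P i)).
Proof.
split=> [/memv_imgP[f _ ->] | [f hf ->]].
  by exists (mpoly_of_dhomog f); [exact: dhomog_is_dhomog | rewrite lfunE].
have -> : \row_i (c i * form_eval f (P i)) =
          linfun (@evaluation F m n P c) (DHomog hf) by rewrite lfunE.
exact: memv_img (memvf _).
Qed.

Definition hamming_dist (F : finFieldType) (n : nat) (u v : 'rV[F]_n) : nat :=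
  #|[set i | u 0 i != v 0 i]|.

(* The neutral element n bounds every Hamming distance from above; it matters
   only for the zero code, whose minimum distance is n by convention. *)
Definition min_dist (F : finFieldType) (n : nat) (C : {vspace 'rV[F]_n}) : nat :=
  \big[minn/n]_(u in C) \big[minn/n]_(v in C | v != u) hamming_dist u v.

Definition floor_2sqrt (q : nat) : int :=
  Num.floor (2 * sqrtC (q%:R : algC)).

Definition delta (q : nat) : int :=
  q%:Z ^+ 2 + 1
  - Num.max (3 * q%:Z + 3)
            (Num.min (4 * q%:Z) (q%:Z + 1 + 4 * floor_2sqrt q)).

(* Main.v *)
Require Import Defs.
From mathcomp Require Import all_boot all_order all_algebra.
From mathcomp Require Import all_fingroup all_solvable all_field.
From mathcomp Require Import mpoly ring zify.

Set Implicit Arguments.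
Unset Strict Implicit.
Unset Printing Implicit Defensive.

Import Order.TTheory GRing.Theory Num.Theory.
Local Open Scope ring_scope.

(** An elliptic quadric is the Weil restriction of the projective line from
    the quadratic extension of F, so that its rational points are the points
    (s : t) of the line over the field with q^2 elements, embedded by
    (s s^q : s t^q : t s^q : t t^q).  A form of degree m restricts to a
    polynomial in s, t, s^q, t^q of bidegree (m, m), that is, to a form of
    degree m (q + 1) in s and t alone.  When m < q the (m + 1)^2 monomials of
    bidegree (m, m) give distinct monomials in s and t, hence a nonzero section
    has at most m (q + 1) zeros among the q^2 + 1 points.  As
    m (q + 1) < q^2 + 1, evaluation is injective on sections, the dimension is
    (m + 1)^2, and the minimum distance is at least q^2 + 1 - m (q + 1)
    ([elliptic_codeP]).  For m = 3 the subtracted term is 3 q + 3, and the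
    maximum subtracted in delta is at least as large.

    The parametrization is obtained as follows.  Chevalley's theorem gives a
    rational point p on the quadric.  No line defined over F lies on the
    quadric, because the Frobenius map fixes such a line but exchanges the
    rulings ([elliptic_no_rational_line]).  Smoothness lets p be completed to a
    hyperbolic pair, and the form is anisotropic on the plane orthogonal to that
    pair since an isotropic vector there would span a rational line with p.
    Thus the form is a (x^2 + b x y + c y^2 - z w) in suitable coordinates
    ([quadf_normal_form]), where x^2 + b x y + c y^2 is the norm
    (x + t y) (x + t^q y) of the quadratic extension generated by t.

    To compute the dimension of the code, which lives over F, from coordinates
    that live over an extension K, the code is described as the row space of a
    matrix of products of coordinates of the points: the rank does not change
    under extension of scalars, and the row space over K does not change under
    a linear change of coordinates ([prodmxS]). *)

(** * Homogeneous polynomials *)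

Lemma mpolyX_prod (R : comNzRingType) (n d : nat) (m : 'X_{1..n}) :
  mdeg m = d ->
  exists g : {ffun 'I_d -> 'I_n}, 'X_[R, m] = \prod_k 'X_(g k).
Proof.
elim: d m => [|d IHd] m md.
  have /eqP : mdeg m == 0%N by rewrite md.
  move/eqP; rewrite mdeg_eq0 => /eqP->.
  have g0 : {ffun 'I_0 -> 'I_n} by apply: finfun => -[].
  by exists g0; rewrite big_ord0 mpolyX0.
have /existsP[i mi] : [exists i, m i != 0%N].
  apply: contraPT md => /existsPn m0; rewrite mdegE big1 // => i _.
  by apply/eqP; rewrite -[_ == _]negbK m0.
have le1 : (U_(i) <= m)%MM by rewrite lep1mP.
have [|g Xg] := IHd (m - U_(i))%MM.
  apply/eqP; rewrite -(eqn_add2r 1) -[X in (_ + X)%N](mdeg1 i) -mdegD.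
  by rewrite submK // md addn1.
exists [ffun k => if unlift ord0 k is Some k' then g k' else i].
rewrite big_ord_recl ffunE unlift_none -{1}(submK le1) mpolyXD mulrC Xg.
by congr (_ * _); apply: eq_bigr => k _; rewrite ffunE liftK.
Qed.

(** Indexing by functions rather than by monomials repeats each monomial, but
    turns a homogeneous polynomial into a sum of products of d linear factors,
    which a linear change of coordinates expands by distributivity. *)
Lemma homog_expand (R : comNzRingType) (n d : nat) (f : {mpoly R[n]}) :
  f \is d.-homog ->
  exists a : {ffun 'I_d -> 'I_n} -> R, f = \sum_g a g *: \prod_k 'X_(g k).
Proof.
move=> /dhomogP hf; rewrite [f]mpolyE.
elim: (msupp f) hf => [|m s IHs] hs.
  by exists (fun=> 0); rewrite big_nil big1 // => g _; rewrite scale0r.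
have [|a def_s] := IHs; first by move=> m' m's; apply: hs; rewrite inE m's orbT.
have [|g0 def_m] := @mpolyX_prod R n d m; first by apply: hs; rewrite mem_head.
exists (fun g => a g + f@_m *+ (g == g0)).
rewrite big_cons def_s def_m addrC.
under [RHS]eq_bigr => g _ do rewrite scalerDl.
rewrite big_split /=; congr (_ + _).
rewrite (bigD1 g0) //= eqxx [X in _ = _ + X]big1 ?addr0 // => g /negPf->.
by rewrite scale0r.
Qed.

Lemma meval_expand (R : comNzRingType) (n d : nat)
    (a : {ffun 'I_d -> 'I_n} -> R) (v : 'I_n -> R) :
  (\sum_g a g *: \prod_k 'X_(g k)).@[v] = \sum_g a g * \prod_k v (g k).
Proof.
rewrite raddf_sum; apply: eq_bigr => g _ /=.
rewrite mevalZ rmorph_prod; congr (_ * _); apply: eq_bigr => k _; exact: mevalXU.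
Qed.

Lemma meval_homogZ (R : comNzRingType) (n d : nat) (f : {mpoly R[n]})
    (a : R) (v : 'I_n -> R) :
  f \is d.-homog -> f.@[fun i => a * v i] = a ^+ d * f.@[v].
Proof.
move=> /homog_expand[c ->]; rewrite !meval_expand mulr_sumr.
by apply: eq_bigr => g _; rewrite big_split /= prodr_const card_ord mulrCA.
Qed.

(** * Zeros of forms over a finite field *)

Lemma finField_card_pnat (F : finFieldType) :
  exists2 p, p \in [pchar F] & p.-nat #|F|.
Proof.
have [p _ pF] := finPcharP F; exists p => //.
by have /abelem_pgroup := fin_ring_pchar_abelem pF; rewrite /pgroup cardsT.
Qed.

Lemma card_finField_natr (F : finFieldType) : #|F|%:R = 0 :> F.
Proof.
have [p pF /p_natP[k qE]] := finField_card_pnat F.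
case: k qE => [q1|k ->]; first by have := finNzRing_gt1 F; rewrite q1.
by apply/eqP; rewrite -(dvdn_pcharf pF) expnS dvdn_mulr.
Qed.

(** For k > 0, some a in F satisfies [a ^+ k != 1], and substituting [a * x]
    for x multiplies the sum by [a ^+ k]. *)
Lemma sum_expr_eq0 (F : finFieldType) (k : nat) :
  (k < #|F|.-1)%N -> \sum_(x : F) x ^+ k = 0.
Proof.
case: k => [|k] lt_k.
  by under eq_bigr do rewrite expr0; rewrite sumr_const card_finField_natr.
have [a a0 ak] : exists2 a : F, a != 0 & a ^+ k.+1 != 1.
  apply/exists_inP; apply: contraTT lt_k => /exists_inPn all1.
  rewrite -leqNgt.
  have nz : ('X^(k.+1) - 1%:P : {poly F}) != 0.
    by rewrite -size_poly_eq0 size_XnsubC.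
  have := @max_poly_roots _ _ [seq x <- enum F | x != 0] nz.
  rewrite size_XnsubC // ltnS filter_uniq ?enum_uniq //.
  have -> : size [seq x <- enum F | x != 0] = #|F|.-1.
    rewrite size_filter -(cardC1 (0 : F)) cardE /enum_mem size_filter.
    by rewrite count_filter; apply: eq_count => x; rewrite !inE andbT.
  apply=> //; apply/allP => x; rewrite mem_filter => /andP[x0 _].
  by rewrite /root !hornerE subr_eq0 -[_ == _]negbK all1.
have bij_a : {on xpredT, bijective *%R a}.
  by apply: onW_bij; exists ( *%R a^-1) => x; rewrite ?mulKf ?mulVKf.
have : \sum_(x : F) x ^+ k.+1 = a ^+ k.+1 * \sum_(x : F) x ^+ k.+1.
  rewrite [LHS](reindex _ bij_a) mulr_sumr; apply: eq_bigr => x _.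
  by rewrite exprMn.
move/eqP; rewrite -subr_eq0 -{1}[X in X - _]mul1r -mulrBl mulf_eq0.
by rewrite subr_eq0 eq_sym (negPf ak) => /eqP.
Qed.

(** Chevalley's theorem for one form: [1 - f ^+ (q - 1)] is the indicator
    function of the zeros of f, and its sum over all vectors vanishes because
    each of its monomials has degree less than q - 1 in some variable; so the
    zero vector cannot be the only zero. *)
Lemma chevalley (F : finFieldType) (n d : nat) (f : {mpoly F[n]}) :
  f \is d.-homog -> (0 < d < n)%N ->
  exists2 v : 'rV[F]_n, v != 0 & f.@[fun j => v 0 j] = 0.
Proof.
move=> hf /andP[d0 dn]; set q1 := #|F|.-1.
have q1_gt0 : (0 < q1)%N.
  by rewrite -ltnS prednK ?finNzRing_gt1 // ltnW ?finNzRing_gt1.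
have [v /andP[v0 /eqP fv]|no0] :=
  pickP (fun v : 'rV[F]_n => (v != 0) && (f.@[fun j => v 0 j] == 0)).
  by exists v.
have sum0 : \sum_(v : {ffun 'I_n -> F}) (f ^+ q1).@[v] = 0.
  have /dhomogP hq : f ^+ q1 \is (d * q1).-homog by exact: dhomogMn.
  rewrite [f ^+ q1]mpolyE.
  under eq_bigr do rewrite raddf_sum.
  rewrite exchange_big big1_seq //= => m /hq md.
  have {}md : mdeg m = (d * q1)%N by [].
  under eq_bigr do rewrite mevalZ mevalX.
  have [i lt_i] : exists i, (m i < q1)%N.
    apply/existsP; apply: contraTT dn => /existsPn ge_m.
    rewrite -leqNgt -(leq_pmul2r q1_gt0) -md mdegE.
    rewrite -{1}(card_ord n) -sum_nat_const.
    by apply: leq_sum => i _; rewrite leqNgt ge_m.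
  have sum_m : \sum_(v : {ffun 'I_n -> F}) \prod_j v j ^+ m j = 0.
    rewrite -(bigA_distr_bigA (fun j (x : F) => x ^+ m j)) /=.
    by rewrite (bigD1 i) //= sum_expr_eq0 // mul0r.
  by rewrite -mulr_sumr -[RHS](mulr0 (f ^+ q1)@_m); congr (_ * _).
have : \sum_(v : {ffun 'I_n -> F}) (1 - (f ^+ q1).@[v]) = 1.
  rewrite (bigD1 [ffun=> 0]) //= rmorphXn /=.
  have -> : f.@[[ffun=> 0]] = 0.
    rewrite -(meval_eq (v1 := fun i => 0 * 0)) => [|i]; last first.
      by rewrite ffunE mul0r.
    by rewrite (meval_homogZ _ _ hf) expr0n -[d == _]negbK -lt0n d0 mul0r.
  rewrite expr0n -[q1 == _]negbK -lt0n q1_gt0 subr0 big1 ?addr0 // => v v0.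
  have fv0 : f.@[v] != 0.
    rewrite -(meval_eq (v1 := fun j => (\row_k v k) 0 j)) => [|i]; last first.
      by rewrite mxE.
    have := no0 (\row_k v k); case: eqP => [/rowP r0|_ /= -> //].
    case/eqP: v0; apply/ffunP => i.
    by have := r0 i; rewrite !mxE !ffunE.
  rewrite rmorphXn /= -(mulKf fv0 (_ ^+ _)) -exprS prednK.
    by rewrite expf_card mulVf // subrr.
  by rewrite ltnW // finNzRing_gt1.
rewrite sumrB sum0 subr0 sumr_const.
have -> : 1 *+ #|{: {ffun 'I_n -> F}}| = 0 :> F.
  rewrite card_ffun card_ord natrX card_finField_natr.
  by rewrite expr0n -[n == _]negbK -lt0n (leq_trans _ dn).
by move/eqP; rewrite eq_sym oner_eq0.
Qed.

(** * Quadratic forms *)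

(** The matrix A need not be symmetric: in characteristic 2 a quadratic form
    is not determined by its polar form. *)
Definition quadf (R : comNzRingType) (n : nat) (A : 'M[R]_n) (v : 'rV[R]_n) : R :=
  (v *m A *m v^T) 0 0.

Definition polar (R : comNzRingType) (n : nat) (A : 'M[R]_n) (u v : 'rV[R]_n) : R :=
  (u *m (A + A^T) *m v^T) 0 0.

Section Quadf.

Variables (R : comNzRingType) (n : nat) (A : 'M[R]_n).
Implicit Types (u v w : 'rV[R]_n) (a : R).

Let bilin_tr (B : 'M[R]_n) u v : (u *m B *m v^T) 0 0 = (v *m B^T *m u^T) 0 0.
Proof.
transitivity ((u *m B *m v^T)^T 0 0); first by rewrite [RHS]mxE.
by rewrite !trmx_mul trmxK mulmxA.
Qed.

Let polarE u v : polar A u v = (u *m A *m v^T) 0 0 + (v *m A *m u^T) 0 0.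
Proof. by rewrite /polar mulmxDr mulmxDl [LHS]mxE (bilin_tr A^T) trmxK. Qed.

Lemma polarC u v : polar A u v = polar A v u.
Proof. by rewrite !polarE addrC. Qed.

Lemma polarDl u v w : polar A (u + v) w = polar A u w + polar A v w.
Proof. by rewrite /polar !mulmxDl mxE. Qed.

Lemma polarZl a u w : polar A (a *: u) w = a * polar A u w.
Proof. by rewrite /polar -!scalemxAl mxE. Qed.

Lemma polar0l w : polar A 0 w = 0.
Proof. by rewrite -(scale0r 0) polarZl mul0r. Qed.

Lemma polarDr u v w : polar A w (u + v) = polar A w u + polar A w v.
Proof. by rewrite !(polarC w) polarDl. Qed.

Lemma polarZr a u w : polar A w (a *: u) = a * polar A w u.
Proof. by rewrite !(polarC w) polarZl. Qed.

Lemma quadfZ a v : quadf A (a *: v) = a ^+ 2 * quadf A v.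
Proof. by rewrite /quadf linearZ /= -scalemxAr -!scalemxAl !mxE mulrA. Qed.

Lemma quadfD u v : quadf A (u + v) = quadf A u + quadf A v + polar A u v.
Proof.
by rewrite polarE /quadf linearD /= !mulmxDl !mulmxDr !mxE; ring.
Qed.

Lemma polarvv v : polar A v v = quadf A v *+ 2.
Proof. by rewrite polarE mulr2n. Qed.

Lemma polar_delta u i : polar A u (delta_mx 0 i) = (u *m (A + A^T)) 0 i.
Proof. by rewrite /polar trmx_delta -colE mxE. Qed.

End Quadf.

Lemma homog2_quadf (R : comNzRingType) (n : nat) (f : {mpoly R[n]}) :
  f \is 2.-homog -> exists A : 'M[R]_n, f = \sum_i \sum_j A i j *: ('X_i * 'X_j).
Proof.
move=> /homog_expand[a ->].
pose ends (g : {ffun 'I_2 -> 'I_n}) := (g ord0, g ord_max).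
exists (\matrix_(i, j) \sum_(g | ends g == (i, j)) a g).
rewrite pair_big /= (partition_big ends xpredT) //=.
apply: eq_bigr => -[i j] _; rewrite mxE scaler_suml.
apply: eq_bigr => g /eqP[<- <-].
by rewrite big_ord_recr big_ord1 /=; congr (_ *: ('X_(g _) * _)); apply/val_inj.
Qed.

Lemma form_eval_quadf (R : comNzRingType) (A : 'M[R]_4) (v : 'rV[R]_4) :
  form_eval (\sum_i \sum_j A i j *: ('X_i * 'X_j)) v = quadf A v.
Proof.
rewrite /form_eval /quadf raddf_sum mxE /=.
under eq_bigr do rewrite raddf_sum.
rewrite exchange_big; apply: eq_bigr => j _; rewrite !mxE mulr_suml.
by apply: eq_bigr => i _ /=; rewrite mevalZ mevalM !mevalXU; ring.
Qed.

Lemma mderivXU (R : nzRingType) (n : nat) (i k : 'I_n) :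
  mderiv k ('X_i : {mpoly R[n]}) = (i == k)%:R.
Proof.
rewrite mderivX mnm1E; case: eqP => [->|_]; last by rewrite scale0r.
have -> : (U_(k) - U_(k) = 0)%MM by apply/mnmP => l; rewrite mnmBE subnn mnm0E.
by rewrite scale1r mpolyX0.
Qed.

(** The gradient of a quadratic form is given by its polar form; smoothness of
    the quadric is thereby a statement on the polar form. *)
Lemma form_eval_mderiv_quadf (R : comNzRingType) (A : 'M[R]_4) (k : 'I_4)
    (v : 'rV[R]_4) :
  form_eval (mderiv k (\sum_i \sum_j A i j *: ('X_i * 'X_j))) v =
  polar A v (delta_mx 0 k).
Proof.
rewrite polar_delta mulmxDr !mxE /form_eval (raddf_sum (mderiv k)) raddf_sum /=.
have pick (G : 'I_4 -> R) : \sum_i (i == k)%:R * G i = G k.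
  rewrite (bigD1 k) //= eqxx mul1r big1 ?addr0 // => i /negPf->.
  by rewrite mul0r.
have -> : \sum_j v 0 j * A^T j k = \sum_i (i == k)%:R * \sum_j A i j * v 0 j.
  by rewrite pick; apply: eq_bigr => j _; rewrite mxE mulrC.
rewrite addrC.
under [X in _ = _ + X]eq_bigr => j _ do
  rewrite -(pick (fun l => v 0 j * A j l)).
rewrite -big_split; apply: eq_bigr => i _ /=.
rewrite (raddf_sum (mderiv k)) raddf_sum mulr_sumr -big_split.
apply: eq_bigr => j _ /=.
rewrite mderivZ mevalZ mderivM mevalD !mevalM !mderivXU !mevalXU.
by rewrite !rmorph_nat; ring.
Qed.

Lemma sum_ord2 (V : zmodType) (G : 'I_2 -> V) : \sum_i G i = G 0 + G 1.
Proof. by rewrite big_ord_recl big_ord1; congr (_ + G _); apply/val_inj. Qed.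

Lemma sum_ord4 (V : zmodType) (G : 'I_4 -> V) :
  \sum_i G i = G 0 + G 1 + G 2 + G 3.
Proof.
rewrite !big_ord_recr big_ord0 /= add0r.
by congr (G _ + G _ + G _ + G _); apply/val_inj.
Qed.

Definition row2 (R : nzRingType) (x y : R) : 'rV[R]_2 :=
  \row_i (if i == 0 then x else y).

Lemma row2P (R : nzRingType) (x : 'rV[R]_2) : x 0 0 = 0 -> x 0 1 = 0 -> x = 0.
Proof.
move=> x0 x1; apply/rowP=> i; rewrite mxE.
by case: i => [[|[|//]] lti]; [rewrite -x0|rewrite -x1]; congr (x _ _);
  apply/val_inj.
Qed.

Lemma row2_mul (R : comNzRingType) (n : nat) (x y : R) (E : 'M[R]_(2, n)) :
  row2 x y *m E = x *: row 0 E + y *: row 1 E.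
Proof. by rewrite mulmx_sum_row sum_ord2 !mxE. Qed.

(** An isotropic vector p, made into a hyperbolic pair with some w by
    regularity, splits off; the form is anisotropic on the orthogonal plane,
    because an isotropic vector of that plane would span an isotropic line
    together with p. *)
Lemma quadf_normal_form (F : fieldType) (A : 'M[F]_4) :
  (exists2 p, p != 0 & quadf A p = 0) ->
  (forall p, p != 0 -> quadf A p = 0 -> exists w, polar A p w != 0) ->
  (forall E : 'M_(2, 4), row_free E -> exists z, quadf A (z *m E) != 0) ->
  exists B : 'M[F]_4, exists a b c : F,
    [/\ B \in unitmx, a != 0, forall x, x ^+ 2 + b * x + c != 0
      & forall v : 'rV_4, quadf A (v *m B) =
          a * (v 0 1 ^+ 2 + b * v 0 1 * v 0 2 + c * v 0 2 ^+ 2 - v 0 0 * v 0 3)].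
Proof.
move=> [p0 p0_neq0 Qp0] regular noline.
have [w0 pw0] := regular _ p0_neq0 Qp0.
have pol_self (u : 'rV_4) : quadf A u = 0 -> polar A u u = 0.
  by move=> Qu; rewrite polarvv Qu mul0rn.
(* Subtracting this multiple of p0 makes w isotropic. *)
pose w := w0 - (quadf A w0 / polar A p0 w0) *: p0.
have Qw : quadf A w = 0.
  rewrite /w -scaleNr quadfD quadfZ Qp0 mulr0 addr0 polarZr (polarC _ w0).
  by rewrite mulNr divfK // subrr.
have p0w : polar A p0 w = polar A p0 w0.
  by rewrite /w -scaleNr polarDr polarZr pol_self // mulr0 addr0.
(* The rows of E span a plane orthogonal to p0 and w. *)
clearbody w; pose T := A + A^T.
pose M : 'M[F]_(4, 1 + 1) := row_mx (T *m p0^T) (T *m w^T).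
have [E E_free EM] : exists2 E : 'M[F]_(2, 4), row_free E & E *m M = 0.
  have rkM : (2 <= \rank (kermx M))%N.
    by rewrite mxrank_ker; have := rank_leq_col M; move: (\rank M) => r; lia.
  exists ((pid_mx 2 : 'M_(2, \rank (kermx M))) *m row_base (kermx M)).
    by rewrite -row_leq_rank mxrankMfree ?row_base_free // rank_pid_mx.
  apply/sub_kermxP; rewrite (submx_trans (submxMl _ _)) //.
  by rewrite eq_row_base.
have ortho (z : 'rV_2) : polar A (z *m E) p0 = 0 /\ polar A (z *m E) w = 0.
  have : z *m E *m M = 0 by rewrite -mulmxA EM mulmx0.
  rewrite mul_mx_row !mulmxA -[0]row_mx0 => /eq_row_mx[Zp Zw].
  by rewrite /polar Zp Zw !mxE.
have aniso (z : 'rV_2) : quadf A (z *m E) = 0 -> z = 0.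
  move=> Qz; apply/eqP/negPn/negP => z0.
  have [zp zw] := ortho z.
  pose L : 'M[F]_(2, 4) := \matrix_i (if i == 0 then p0 else z *m E).
  have LE (x : 'rV_2) : x *m L = x 0 0 *: p0 + x 0 1 *: (z *m E).
    by rewrite mulmx_sum_row sum_ord2 !rowK.
  have [|x] := noline L.
    apply: inj_row_free => x; rewrite LE => xL0.
    have x0 : x 0 0 = 0.
      have := congr1 (fun u => polar A u w) xL0; rewrite polarDl !polarZl zw.
      rewrite mulr0 addr0 p0w polar0l => /eqP.
      by rewrite mulf_eq0 (negPf pw0) orbF => /eqP.
    move: xL0; rewrite x0 scale0r add0r => /eqP.
    rewrite scaler_eq0 mulmx_free_eq0 // (negPf z0) orbF => /eqP x1.
    exact/row2P.
  rewrite LE quadfD !quadfZ Qp0 Qz !mulr0 !add0r polarZl polarZr polarC zp.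
  by rewrite !mulr0 eqxx.
pose e := row 0 E; pose f := row 1 E.
have eE : e = row2 1 0 *m E by rewrite row2_mul scale1r scale0r addr0.
have row2_eq0 x y : row2 x y = 0 -> x = 0 /\ y = 0.
  by move=> /rowP r0; have := r0 0; have := r0 1; rewrite !mxE.
have Qe : quadf A e != 0.
  apply/eqP; rewrite eE => /aniso/row2_eq0[/eqP].
  by rewrite oner_eq0.
pose a := quadf A e; pose b := polar A e f / a; pose c := quadf A f / a.
(* This multiple of p0 makes a factor out of the whole form. *)
pose p := (- a / polar A p0 w) *: p0.
have pw : polar A p w = - a by rewrite polarZl divfK // p0w.
have Qp : quadf A p = 0 by rewrite quadfZ Qp0 mulr0.
have oE0 z : polar A (z *m E) p = 0 by rewrite polarZr (ortho z).1 mulr0.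
have oE1 z : polar A (z *m E) w = 0 by rewrite (ortho z).2.
clearbody p.
pose B : 'M[F]_4 := \matrix_i nth 0 [:: p; e; f; w] i.
have BE (v : 'rV_4) :
    v *m B = v 0 0 *: p + v 0 3 *: w + row2 (v 0 1) (v 0 2) *m E.
  rewrite mulmx_sum_row sum_ord4 !rowK /= row2_mul -/e -/f.
  by rewrite -!addrA; congr (_ + _); rewrite addrA addrC.
have QE x y : quadf A (row2 x y *m E) = a * (x ^+ 2 + b * x * y + c * y ^+ 2).
  rewrite row2_mul quadfD !quadfZ polarZl polarZr -/e -/f -/a.
  by rewrite /b /c; field.
have QB (v : 'rV_4) : quadf A (v *m B) =
    a * (v 0 1 ^+ 2 + b * v 0 1 * v 0 2 + c * v 0 2 ^+ 2 - v 0 0 * v 0 3).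
  rewrite BE quadfD QE quadfD !quadfZ Qp Qw polarZl polarZr pw.
  rewrite polarDl !polarZl !(polarC _ _ (_ *m E)) oE0 oE1.
  by ring.
exists B, a, b, c; split=> //.
- rewrite -row_free_unit; apply: inj_row_free => v vB0.
  have a0 : - a != 0 by rewrite oppr_eq0.
  have polB u : polar A (v *m B) u = 0 by rewrite vB0 polar0l.
  have v3 : v 0 3 = 0.
    have := polB p; rewrite BE !polarDl !polarZl oE0 pol_self // (polarC _ w) pw.
    by rewrite mulr0 add0r addr0 => /eqP; rewrite mulf_eq0 (negPf a0) orbF => /eqP.
  have v0 : v 0 0 = 0.
    have := polB w; rewrite BE !polarDl !polarZl oE1 pol_self // pw.
    by rewrite mulr0 !addr0 => /eqP; rewrite mulf_eq0 (negPf a0) orbF => /eqP.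
  have [v1 v2] : v 0 1 = 0 /\ v 0 2 = 0.
    apply/row2_eq0/aniso; move: vB0; rewrite BE v0 v3 !scale0r !add0r => ->.
    by rewrite /quadf !mul0mx mxE.
  apply/rowP=> -[[|[|[|[|//]]]] lti]; rewrite mxE.
  - by rewrite -v0; congr (v _ _); apply/val_inj.
  - by rewrite -v1; congr (v _ _); apply/val_inj.
  - by rewrite -v2; congr (v _ _); apply/val_inj.
  - by rewrite -v3; congr (v _ _); apply/val_inj.
- move=> x; apply/eqP => x0.
  have := QE x 1; rewrite mulr1 expr1n mulr1 x0 mulr0 => /aniso/row2_eq0[_ /eqP].
  by rewrite oner_eq0.
Qed.

(** * Rational structure of an elliptic quadric *)

Lemma exprD_card (F : finFieldType) (K : fieldType) (iota : {rmorphism F -> K})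
    (x y : K) : (x + y) ^+ #|F| = x ^+ #|F| + y ^+ #|F|.
Proof.
have [p pF pq] := finField_card_pnat F.
have pK : p \in [pchar K] by rewrite (fmorph_pchar iota).
by apply: exprDn_pchar; rewrite (eq_pnat _ (pcharf_eq pK)).
Qed.

Lemma fmorph_expr_card (F : finFieldType) (K : fieldType)
    (iota : {rmorphism F -> K}) (a : F) : iota a ^+ #|F| = iota a.
Proof. by rewrite -rmorphXn expf_card. Qed.

Lemma dimv_row_span (F : fieldType) (k n : nat) (U : {vspace 'rV[F]_n})
    (E : 'M[F]_(k, n)) :
  (forall w : 'rV[F]_n, (w \in U) = (w <= E)%MS) -> \dim U = \rank E.
Proof.
move=> UE; pose phi := linfun (mulmxr (row_base E) : 'rV_(\rank E) -> 'rV_n).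
have <- : (phi @: fullv)%VS = U.
  apply/vspaceP=> w; have -> : (w \in U) = (w <= row_base E)%MS.
    by rewrite UE eq_row_base.
  apply/memv_imgP/submxP.
    by case=> a _ ->; exists a; rewrite lfunE.
  by case=> a ->; exists a; rewrite ?memvf ?lfunE.
rewrite limg_dim_eq ?dimvf /dim /= ?mul1n //.
apply/eqP; rewrite -subv0; apply/subvP=> a.
rewrite memv_cap memvf memv_ker lfunE /= memv0 => /eqP a0; apply/eqP.
by apply: (row_free_inj (row_base_free E)); rewrite a0 mul0mx.
Qed.

Section Elliptic.

Variables (F : finFieldType) (K : closedFieldType) (iota : {rmorphism F -> K}).
Variables (A : 'M[F]_4) (Q : {mpoly F[4]}).
Hypothesis QA : Q = \sum_i \sum_j A i j *: ('X_i * 'X_j).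
Hypothesis Q_elliptic : elliptic_quadric iota Q.

Let map_Q :
  map_mpoly iota Q = \sum_i \sum_j (map_mx iota A) i j *: ('X_i * 'X_j).
Proof.
rewrite QA raddf_sum; apply: eq_bigr => i _ /=.
rewrite raddf_sum; apply: eq_bigr => j _ /=.
by rewrite map_mpolyZ rmorphM /= mxE; congr (_ *: (_ * _)); apply: map_mpolyX.
Qed.

Let map_quadf v : quadf (map_mx iota A) (map_mx iota v) = iota (quadf A v).
Proof. by rewrite /quadf map_trmx -!map_mxM mxE. Qed.

Let map_polar u v :
  polar (map_mx iota A) (map_mx iota u) (map_mx iota v) = iota (polar A u v).
Proof. by rewrite /polar !map_trmx -map_mxD -!map_mxM mxE. Qed.

Lemma elliptic_regular (p : 'rV[F]_4) :
  p != 0 -> quadf A p = 0 -> exists w, polar A p w != 0.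
Proof.
move=> p0 Qp; have [_ smoothQ _] := Q_elliptic.
have [||i] := smoothQ (map_mx iota p); first by rewrite map_mx_eq0.
  by rewrite map_Q form_eval_quadf map_quadf Qp rmorph0.
rewrite map_Q form_eval_mderiv_quadf -(map_delta_mx iota) map_polar fmorph_eq0.
by exists (delta_mx 0 i).
Qed.

(** A line defined over F is fixed by the Frobenius map, whereas the latter
    sends each ruling to the other one and the rulings have no common line. *)
Lemma elliptic_no_rational_line (E : 'M[F]_(2, 4)) :
  row_free E -> exists z, quadf A (z *m E) != 0.
Proof.
move=> E_free; apply/existsP; apply: contraT => /existsPn E0.
have {}E0 z : quadf A (z *m E) = 0 by apply/eqP; rewrite -[_ == _]negbK E0.
have [_ _ [R1 [R2 [[R1ruling R2ruling R12 R12disj] frobR]]]] := Q_elliptic.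
pose EK := map_mx iota E.
pose L := limg (linfun (mulmxr EK : 'rV_2 -> 'rV_4)).
have LE (v : 'rV[K]_4) : (v \in L) = (v <= EK)%MS.
  by apply/memv_imgP/submxP => [[z _ ->]|[z ->]]; exists z;
    rewrite ?memvf ?lfunE.
have dimL : \dim L = 2.
  by rewrite (dimv_row_span LE) mxrank_map; apply/eqP.
have lineL : line_on (map_mpoly iota Q) L.
  split=> // v; rewrite LE => /submxP[z ->]; rewrite map_Q form_eval_quadf.
  have -> : z = row2 (z 0 0) (z 0 1).
    apply/esym/eqP; rewrite -subr_eq0.
    by apply/eqP/row2P; rewrite !mxE subrr.
  (* A binary quadratic form that vanishes at (1, 0), (0, 1) and (1, 1) is
     zero, so its zeros over F suffice to see that it vanishes over K. *)
  have r0 : row 0 EK = map_mx iota (row2 1 0 *m E).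
    by rewrite row2_mul scale1r scale0r addr0 map_row.
  have r1 : row 1 EK = map_mx iota (row2 0 1 *m E).
    by rewrite row2_mul scale1r scale0r add0r map_row.
  have r01 : row 0 EK + row 1 EK = map_mx iota (row2 1 1 *m E).
    by rewrite row2_mul !scale1r map_mxD !map_row.
  have Q0 : quadf (map_mx iota A) (row 0 EK) = 0.
    by rewrite r0 map_quadf E0 rmorph0.
  have Q1 : quadf (map_mx iota A) (row 1 EK) = 0.
    by rewrite r1 map_quadf E0 rmorph0.
  have : quadf (map_mx iota A) (row 0 EK + row 1 EK) = 0.
    by rewrite r01 map_quadf E0 rmorph0.
  rewrite quadfD Q0 Q1 !add0r => pol01.
  by rewrite row2_mul quadfD !quadfZ polarZl polarZr Q0 Q1 pol01 !mulr0 !addr0.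
have frobL : frobenius #|F| L = L.
  have [fR1 fR2] := frobR L.
  have dim_frob : \dim (frobenius #|F| L) = 2.
    by case: (R12 _ lineL) => [/fR1/(proj1 R2ruling)[]|/fR2/(proj1 R1ruling)[]].
  apply/eqP; rewrite eqEdim dim_frob dimL leqnn andbT.
  apply/span_subvP => _ /mapP[v vL ->].
  have : v \in L by apply: vbasis_mem.
  rewrite !LE => /submxP[z ->]; apply/submxP.
  exists (map_mx (fun x : K => x ^+ #|F|) z).
  apply/rowP=> j; rewrite !mxE !sum_ord2 (exprD_card iota) !exprMn !mxE.
  by rewrite !fmorph_expr_card.
have [fR1 fR2] := frobR L; rewrite frobL in fR1 fR2.
have [R1L|R2L] := R12 _ lineL; case: (R12disj L); split=> //.
  exact: fR1.
exact: fR2.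
Qed.

Lemma elliptic_normal_form :
  exists B : 'M[F]_4, exists a b c : F,
    [/\ B \in unitmx, a != 0, forall x, x ^+ 2 + b * x + c != 0
      & forall v : 'rV_4, form_eval Q (v *m B) =
          a * (v 0 1 ^+ 2 + b * v 0 1 * v 0 2 + c * v 0 2 ^+ 2 - v 0 0 * v 0 3)].
Proof.
have QE v : form_eval Q v = quadf A v by rewrite QA form_eval_quadf.
have isotropic : exists2 p, p != 0 & quadf A p = 0.
  have [homQ _ _] := Q_elliptic.
  by have [//|p p0 Qp] := chevalley homQ; exists p => //; rewrite -QE.
have [B [a [b [c [Bu a0 irr norm]]]]] :=
  quadf_normal_form isotropic elliptic_regular elliptic_no_rational_line.
by exists B, a, b, c; split=> // v; rewrite QE norm.
Qed.

End Elliptic.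

(** * Parametrization of the points *)

Definition row4 (R : nzRingType) (x0 x1 x2 x3 : R) : 'rV[R]_4 :=
  \row_i nth 0 [:: x0; x1; x2; x3] i.

Lemma row4P (R : nzRingType) (u v : 'rV[R]_4) :
  u 0 0 = v 0 0 -> u 0 1 = v 0 1 -> u 0 2 = v 0 2 -> u 0 3 = v 0 3 -> u = v.
Proof.
move=> e0 e1 e2 e3; apply/rowP=> i.
have : [|| i == 0, i == 1, i == 2 | i == 3] by case: i => -[|[|[|[|]]]].
by case/or4P => /eqP->.
Qed.

(** Equations and points are taken here in the coordinates of the normal form:
    the quadric is [z1^2 + b z1 z2 + c z2^2 = z0 z3].  The only rational
    point in the plane [z3 = 0] is (1 : 0 : 0 : 0), because the norm form is
    anisotropic, and projection from that point identifies the others with an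
    affine plane. *)
Section Cone.

Variables (F : fieldType) (b c : F).
Hypothesis irr : forall x, x ^+ 2 + b * x + c != 0.
Implicit Types (z : 'rV[F]_4) (o : option (F * F)).

Let N (x y : F) : F := x ^+ 2 + b * x * y + c * y ^+ 2.

Definition on_cone z : Prop := N (z 0 1) (z 0 2) = z 0 0 * z 0 3.

Definition cone_point o : 'rV[F]_4 :=
  if o is Some (x, y) then row4 (N x y) x y 1 else row4 1 0 0 0.

Definition cone_class z : option (F * F) :=
  if z 0 3 == 0 then None else Some (z 0 1 / z 0 3, z 0 2 / z 0 3).

Definition cone_scale z : F := if z 0 3 == 0 then z 0 0 else z 0 3.

Lemma norm_eq0 x y : N x y = 0 -> x = 0 /\ y = 0.
Proof.
have [->|y0] := eqVneq y 0.
  rewrite /N mulr0 expr0n /= mulr0 !addr0 => /eqP.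
  by rewrite expf_eq0 => /eqP.
move=> Nxy; case/eqP: (irr (x / y)); apply: (mulfI (expf_neq0 2 y0)).
by rewrite mulr0 -Nxy /N; field.
Qed.

Lemma cone_pointP o : on_cone (cone_point o).
Proof. by case: o => [[x y]|]; rewrite /on_cone /cone_point !mxE /= /N; ring. Qed.

Lemma cone_point_neq0 o : cone_point o != 0.
Proof.
apply/eqP => /rowP z0; case: o z0 => [[x y]|] z0.
  by have := z0 3; rewrite !mxE /= => /eqP; rewrite oner_eq0.
by have := z0 0; rewrite !mxE /= => /eqP; rewrite oner_eq0.
Qed.

Lemma cone_scaleK z : on_cone z -> z = cone_scale z *: cone_point (cone_class z).
Proof.
rewrite /on_cone /cone_scale /cone_class; case: eqP => [z3|/eqP z3] Nz.
  have [z1 z2] : z 0 1 = 0 /\ z 0 2 = 0 by apply: norm_eq0; rewrite Nz z3 mulr0.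
  by apply: row4P; rewrite !mxE /= ?mulr1 ?mulr0.
have z0 : z 0 0 = N (z 0 1) (z 0 2) / z 0 3 by rewrite Nz mulfK.
by apply: row4P; rewrite !mxE /= ?z0 /N; field.
Qed.

Lemma cone_scale_neq0 z : on_cone z -> z != 0 -> cone_scale z != 0.
Proof.
by move=> Nz; apply: contra => /eqP e0; rewrite (cone_scaleK Nz) e0 scale0r.
Qed.

Lemma cone_classK e o : e != 0 -> cone_class (e *: cone_point o) = o.
Proof.
move=> e0; case: o => [[x y]|]; rewrite /cone_class !mxE /=.
  by rewrite mulr1 (negPf e0); congr (Some (_, _)); field.
by rewrite mulr0 eqxx.
Qed.

End Cone.

(** Proportional points have the same class, and the class determines the point
    up to proportionality; since P lists each rational point once, its indices
    correspond to the classes, of which there are q^2 + 1. *)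
Lemma class_bijective (F : finFieldType) (Q : {mpoly F[4]}) (n : nat)
    (P : 'I_n -> 'rV[F]_4) (B : 'M[F]_4) (a b c : F) :
  rational_points Q P -> B \in unitmx -> a != 0 ->
  (forall x, x ^+ 2 + b * x + c != 0) ->
  (forall v : 'rV_4, form_eval Q (v *m B) =
     a * (v 0 1 ^+ 2 + b * v 0 1 * v 0 2 + c * v 0 2 ^+ 2 - v 0 0 * v 0 3)) ->
  (forall i, on_cone b c (P i *m invmx B)) /\
  bijective (fun i => cone_class (P i *m invmx B)).
Proof.
move=> [P_on P_all] Bu a0 irr QB.
have coneE z : form_eval Q (z *m B) = 0 <-> on_cone b c z.
  rewrite QB /on_cone; split=> [/eqP|->]; last by rewrite subrr mulr0.
  by rewrite mulf_eq0 (negPf a0) subr_eq0 => /eqP.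
have Pcone i : on_cone b c (P i *m invmx B).
  by apply/coneE; rewrite mulmxKV //; case: (P_on i).
split=> //.
have mulB0 (z : 'rV_4) : (z *m B == 0) = (z == 0).
  by rewrite mulmx_free_eq0 // row_free_unit.
have mulVB0 (z : 'rV_4) : (z *m invmx B == 0) = (z == 0).
  by rewrite mulmx_free_eq0 // row_free_unit unitmx_inv.
have surj o : {i | cone_class (P i *m invmx B) = o}.
  apply: sig_eqW.
  have z0 : cone_point b c o *m B != 0 by rewrite mulB0 cone_point_neq0.
  have zQ : form_eval Q (cone_point b c o *m B) = 0 by apply/coneE/cone_pointP.
  have [i [[e def_z] _]] := P_all _ z0 zQ; exists i.
  have e0 : e != 0 by apply: contra z0 => /eqP e0; rewrite def_z e0 scale0r.
  have -> : P i *m invmx B = e^-1 *: cone_point b c o.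
    by rewrite -[cone_point b c o](mulmxK Bu) def_z -scalemxAl scalerK.
  by apply/cone_classK; rewrite invr_eq0.
have inj : injective (fun i => cone_class (P i *m invmx B)).
  move=> i j eq_ij; have [Pj0 QPj] := P_on j.
  have [k [_ uniq_k]] := P_all _ Pj0 QPj.
  rewrite -(uniq_k j); last by exists 1; rewrite scale1r.
  apply/esym/uniq_k.
  set zi := P i *m invmx B in eq_ij; set zj := P j *m invmx B in eq_ij.
  have ei : cone_scale zi != 0.
    by apply: (cone_scale_neq0 irr (Pcone i)); rewrite mulVB0; case: (P_on i).
  exists (cone_scale zj / cone_scale zi).
  apply: (can_inj (mulmxKV Bu)).
  have di : zi = _ := cone_scaleK irr (Pcone i).
  have dj : zj = _ := cone_scaleK irr (Pcone j).
  rewrite -scalemxAl -/zi -/zj [LHS]dj -eq_ij [X in _ = _ *: X]di.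
  by rewrite scalerA divfK.
exists (fun o => sval (surj o)) => [i|o]; last by case: (surj o).
by apply: inj; case: (surj _).
Qed.

(** The Frobenius map permutes the roots of [T^2 - b T + c], and it cannot fix a
    root t, which would otherwise lie in F; hence the other root is t^q. *)
Lemma conjugate_roots (F : finFieldType) (K : closedFieldType)
    (iota : {rmorphism F -> K}) (b c : F) :
  (forall x, x ^+ 2 + b * x + c != 0) ->
  exists t : K, [/\ t ^+ #|F| != t, t + t ^+ #|F| = iota b,
                    t * t ^+ #|F| = iota c & forall x, t != iota x].
Proof.
move=> irr; set q := #|F|.
pose p : {poly K} := 'X^2 - (iota b) *: 'X + (iota c)%:P.
have [t pt] : exists t, root p t.
  apply/closed_rootP; rewrite /p -addrA size_polyDl size_polyXn //.
  rewrite ltnS (leq_trans (size_polyD _ _)) // geq_max size_polyN.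
  by rewrite (leq_trans (size_scale_leq _ _)) ?size_polyX // size_polyC; case: eqP.
have {p pt} t2 : t ^+ 2 = iota b * t - iota c.
  move/rootP: pt; rewrite /p !hornerE => /eqP.
  by rewrite -addrA addr_eq0 opprD opprK => /eqP.
have tF x : t != iota x.
  apply/eqP => tx; case/eqP: (irr (- x)); apply: (fmorph_inj iota).
  rewrite !(rmorph0, rmorphD, rmorphM, rmorphXn, rmorphN) /= -tx.
  by transitivity (t ^+ 2 - (iota b * t - iota c)); [ring | rewrite t2 subrr].
have tq : t ^+ q != t.
  apply/negP => /eqP tq.
  have : root (map_poly iota ('X^q - 'X)) t.
    by rewrite /root rmorphB /= map_polyXn map_polyX !hornerE tq subrr.
  rewrite finField_genPoly rmorph_prod /= /root horner_prod prodf_seq_eq0.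
  case/hasP => x _; rewrite /= rmorphB /= map_polyX map_polyC !hornerE subr_eq0.
  by rewrite (negPf (tF x)).
have tq2 : (t ^+ q) ^+ 2 = iota b * t ^+ q - iota c.
  rewrite exprAC t2 /q; apply: (addIr (iota c ^+ #|F|)).
  by rewrite -(exprD_card iota) subrK exprMn !fmorph_expr_card subrK.
have tr : t + t ^+ q = iota b.
  have dq : t ^+ q - t != 0 by rewrite subr_eq0.
  by apply: (mulIf dq); transitivity ((t ^+ q) ^+ 2 - t ^+ 2);
    [ring | rewrite t2 tq2; ring].
exists t; split=> //.
have -> : t ^+ q = iota b - t by rewrite -tr; ring.
by transitivity (iota b * t - t ^+ 2); [ring | rewrite t2; ring].
Qed.

(** * Products of rows *)

(** The rows are the products of m rows of A, one for each choice of m rows; the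
    weight c carries the coordinates chosen on the fibres. *)
Definition prodmx (K : fieldType) (m r n : nat) (c : 'I_n -> K)
    (A : 'M[K]_(r, n)) : 'M[K]_(#|{: {ffun 'I_m -> 'I_r}}|, n) :=
  \matrix_(g, i)
    (c i * \prod_k A ((enum_val g : {ffun 'I_m -> 'I_r}) k) i).

Lemma sub_prodmxP (K : fieldType) (m r n : nat) (c : 'I_n -> K)
    (A : 'M[K]_(r, n)) (w : 'rV[K]_n) :
  reflect (exists a : {ffun 'I_m -> 'I_r} -> K,
             w = \row_i (c i * \sum_g a g * \prod_k A (g k) i))
          (w <= prodmx m c A)%MS.
Proof.
have comb (a : 'rV[K]_#|{: {ffun 'I_m -> 'I_r}}|) :
    a *m prodmx m c A =
    \row_i (c i * \sum_g a 0 (enum_rank g) * \prod_k A (g k) i).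
  apply/rowP=> i; rewrite !mxE mulr_sumr (reindex enum_rank) /=; last first.
    by apply: onW_bij; exact: enum_rank_bij.
  by apply: eq_bigr => g _; rewrite !mxE enum_rankK mulrCA.
apply: (iffP submxP) => [[a ->]|[a ->]].
  by exists (fun g => a 0 (enum_rank g)); rewrite comb.
exists (\row_g a (enum_val g)); rewrite comb; apply/rowP=> i; rewrite !mxE.
by congr (_ * _); apply: eq_bigr => g _; rewrite mxE enum_rankK.
Qed.

(** The span of the products depends only on the span of the factors, by
    distributivity; this is what makes the code insensitive to a linear change
    of coordinates. *)
Lemma prodmxS (K : fieldType) (m r1 r2 n : nat) (c : 'I_n -> K)
    (A : 'M[K]_(r1, n)) (B : 'M[K]_(r2, n)) :
  (A <= B)%MS -> (prodmx m c A <= prodmx m c B)%MS.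
Proof.
move=> /submxP[W ->]; apply/row_subP=> g; apply/sub_prodmxP.
exists (fun h => \prod_k W ((enum_val g : {ffun 'I_m -> 'I_r1}) k) (h k)).
apply/rowP=> i; rewrite !mxE.
congr (_ * _); under eq_bigr do rewrite mxE.
by rewrite bigA_distr_bigA; apply: eq_bigr => h _; rewrite big_split.
Qed.

Lemma map_prodmx (F K : fieldType) (iota : {rmorphism F -> K}) (m r n : nat)
    (c : 'I_n -> F) (A : 'M[F]_(r, n)) :
  map_mx iota (prodmx m c A) = prodmx m (iota \o c) (map_mx iota A).
Proof.
apply/matrixP=> g i; rewrite !mxE rmorphM rmorph_prod /=.
by congr (_ * _); apply: eq_bigr => k _; rewrite mxE.
Qed.

(** * Bihomogeneous forms on the projective line *)

(** The projective line is encoded as [option K]: [Some u] is the point (u : 1)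
    and [None] is the point (1 : 0) at infinity.  The boolean [true] stands for
    the homogeneous coordinate s, and [false] for t. *)
Definition hcoord (K : fieldType) (b : bool) (o : option K) : K :=
  if o is Some u then if b then u else 1 else b%:R.

(** The index k in 0, 1, 2, 3 stands for [s s^q], [s t^q], [t s^q], [t t^q]: its
    two binary digits select the factors. *)
Definition segre (K : fieldType) (q : nat) (o : option K) (k : 'I_4) : K :=
  hcoord (k < 2)%N o * hcoord (~~ odd k) o ^+ q.

Definition bimon (K : fieldType) (m q i j : nat) (o : option K) : K :=
  hcoord true o ^+ i * hcoord false o ^+ (m - i) *
  (hcoord true o ^+ j * hcoord false o ^+ (m - j)) ^+ q.

Definition bimonmx (K : fieldType) (m q n : nat) (c : 'I_n -> K)
    (o : 'I_n -> option K) : 'M[K]_(#|{: 'I_m.+1 * 'I_m.+1}|, n) :=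
  \matrix_(x, l)
    let: (i, j) := (enum_val x : 'I_m.+1 * 'I_m.+1) in c l * bimon m q i j (o l).

Lemma prod_hcoord (K : fieldType) (m : nat) (b : pred 'I_m) (o : option K) :
  \prod_k hcoord (b k) o = hcoord true o ^+ #|b| * hcoord false o ^+ (m - #|b|).
Proof.
rewrite (bigID b) /=; congr (_ * _).
  by under eq_bigr => k -> do []; rewrite prodr_const.
have -> : (m - #|b| = #|predC b|)%N.
  by rewrite -[RHS](addKn #|b|) cardC card_ord.
by under eq_bigr => k /negPf-> do []; rewrite prodr_const.
Qed.

Lemma card_ord_lt (m i : nat) : (i <= m)%N -> #|[pred k : 'I_m | (k < i)%N]| = i.
Proof.
move=> le_im; rewrite -sum1_card -[RHS]card_ord -sum1_card.
by rewrite (big_ord_widen _ (fun=> 1%N) le_im).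
Qed.

Lemma prod_segre (K : fieldType) (m q : nat) (g : 'I_m -> 'I_4) (o : option K) :
  \prod_k segre q o (g k) =
  bimon m q #|[pred k | (g k < 2)%N]| #|[pred k | ~~ odd (g k)]| o.
Proof.
rewrite big_split /= prodrXl.
rewrite (prod_hcoord [pred k | (g k < 2)%N]).
by rewrite (prod_hcoord [pred k | ~~ odd (g k)]).
Qed.

(** In a product of m of the four coordinates, the numbers i of factors
    involving [s] and j of factors involving [s^q] can be prescribed
    independently: the coordinate ring of the quadric in degree m is spanned
    by all monomials of bidegree (m, m). *)
Lemma prodmx_segre (K : fieldType) (m q n : nat) (c : 'I_n -> K)
    (o : 'I_n -> option K) :
  (prodmx m c (\matrix_(k, l) segre q (o l) k) :=: bimonmx m q c o)%MS.
Proof.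
apply/eqmxP/andP; split; apply/row_subP=> x.
  set g : {ffun 'I_m -> 'I_4} := enum_val x.
  have lt_pred (b : pred 'I_m) : (#|b| < m.+1)%N.
    by rewrite ltnS -[X in (_ <= X)%N]card_ord max_card.
  pose y := (Ordinal (lt_pred [pred k | (g k < 2)%N]),
             Ordinal (lt_pred [pred k | ~~ odd (g k)])).
  suff -> : row x (prodmx m c (\matrix_(k, l) segre q (o l) k)) =
            row (enum_rank y) (bimonmx m q c o) by exact: row_sub.
  apply/rowP=> l; rewrite !mxE enum_rankK.
  by under eq_bigr do rewrite mxE; rewrite prod_segre.
case def_x : (enum_val x) => [i j].
(* The k-th factor involves s when k < i and s^q when k < j. *)
pose g := [ffun k : 'I_m => inord (2 * ~~ (k < i)%N + ~~ (k < j)%N)%N : 'I_4].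
suff -> : row x (bimonmx m q c o) =
          row (enum_rank g) (prodmx m c (\matrix_(k, l) segre q (o l) k)).
  exact: row_sub.
have gE k : g k = (2 * ~~ (k < i)%N + ~~ (k < j)%N)%N :> nat.
  by rewrite ffunE inordK //; case: (k < i)%N; case: (k < j)%N.
apply/rowP=> l; rewrite !mxE def_x /= enum_rankK.
under eq_bigr do rewrite mxE.
rewrite prod_segre.
have -> : #|[pred k | (g k < 2)%N]| = i.
  rewrite -[RHS](@card_ord_lt m) -1?ltnS //; apply: eq_card => k.
  by rewrite !inE gE; case: (k < i)%N; case: (k < j)%N.
have -> // : #|[pred k | ~~ odd (g k)]| = j.
rewrite -[RHS](@card_ord_lt m) -1?ltnS //; apply: eq_card => k.
by rewrite !inE gE; case: (k < i)%N; case: (k < j)%N.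
Qed.

(** On the points [(u : 1)] the combination is a polynomial in u of degree at
    most m (q + 1), which is not zero because the exponents i + q j are
    distinct for i, j <= m < q.  The point at infinity is a zero exactly when
    the coefficient of degree m (q + 1) vanishes; the polynomial then has
    smaller degree, and one zero fewer in the affine part. *)
Lemma bimonmx_zeros (K : fieldType) (m q n : nat) (c : 'I_n -> K)
    (o : 'I_n -> option K) (w : 'rV[K]_#|{: 'I_m.+1 * 'I_m.+1}|) :
  (m < q)%N -> (forall l, c l != 0) -> injective o -> w != 0 ->
  (#|[set l | ((w *m bimonmx m q c o) 0 l == 0)%R]| <= m * q.+1)%N.
Proof.
move=> lt_mq c0 o_inj w0; set Z := [set l | _].
pose G : {poly K} := \sum_(x : 'I_m.+1 * 'I_m.+1)
  w 0 (enum_rank x) *: 'X^(x.1 + q * x.2).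
have q0 : (0 < q)%N by apply: leq_trans lt_mq.
have expE (x y : 'I_m.+1 * 'I_m.+1) :
    (x.1 + q * x.2 == y.1 + q * y.2)%N = (x == y).
  case: x y => [i j] [i' j'] /=; apply/eqP/eqP => [e|[-> ->] //].
  have lt_q (a : 'I_m.+1) : (a < q)%N by apply: leq_trans lt_mq.
  congr (_, _); apply/val_inj => /=.
    have := congr1 (modn^~ q) e.
    by rewrite ![(_ + q * _)%N]addnC !(mulnC q) !modnMDl !modn_small.
  have := congr1 (divn^~ q) e.
  by rewrite ![(_ + q * _)%N]addnC !(mulnC q) !divnMDl // !divn_small // !addn0.
have coefG (x : 'I_m.+1 * 'I_m.+1) : G`_(x.1 + q * x.2) = w 0 (enum_rank x).
  rewrite coef_sum (bigD1 x) //= coefZ coefXn eqxx mulr1 big1 ?addr0 // => y yx.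
  by rewrite coefZ coefXn expE eq_sym (negPf yx) mulr0.
have G0 : G != 0.
  apply: contra w0 => /eqP G0; apply/eqP/rowP=> x.
  by rewrite mxE -(enum_valK x) -coefG G0 coef0.
have sizeG : (size G <= (m * q.+1).+1)%N.
  apply: (leq_trans (size_sum _ _ _)); apply/bigmax_leqP => -[i j] _ /=.
  rewrite (leq_trans (size_scale_leq _ _)) // size_polyXn ltnS mulnS mulnC.
  by rewrite leq_add ?leq_mul // -ltnS.
have wE l : (w *m bimonmx m q c o) 0 l =
    c l * (if o l is Some u then G.[u] else G`_(m * q.+1)).
  rewrite mxE (reindex enum_rank) /=; last first.
    by apply: onW_bij; exact: enum_rank_bij.
  transitivity (c l * \sum_(x : 'I_m.+1 * 'I_m.+1)
      w 0 (enum_rank x) * bimon m q x.1 x.2 (o l)).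
    rewrite mulr_sumr; apply: eq_bigr => x _; rewrite !mxE enum_rankK.
    by case: x => i j; rewrite mulrCA.
  rewrite /bimon /hcoord; congr (_ * _); case: (o l) => [u|] /=.
    rewrite horner_sum; apply: eq_bigr => x _.
    by rewrite hornerZ hornerXn !expr1n !mulr1 -exprM mulnC -exprD.
  rewrite mulnS (mulnC m) (coefG (ord_max, ord_max)).
  rewrite (bigD1 (ord_max, ord_max)) //= subnn.
  rewrite !expr1n !mul1r !expr0 expr1n mulr1 big1 ?addr0 // => -[i j] ij.
  rewrite /= !expr1n !mul1r !expr0n.
  case: eqP => [i_m|_]; last by rewrite mul0r mulr0.
  case: eqP => [j_m|_]; last by rewrite expr0n -[q == _]negbK -lt0n q0 !mulr0.
  case/eqP: ij; congr (_, _); apply/val_inj/eqP; rewrite eqn_leq -ltnS ltn_ord /=.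
    by rewrite -subn_eq0 i_m.
  by rewrite -subn_eq0 j_m.
have oZ : {in Z, forall l,
    if o l is Some u then root G u else G`_(m * q.+1) == 0}.
  move=> l; rewrite inE wE mulf_eq0 (negPf (c0 l)) /=; case: (o l) => //.
pose os := [seq o l | l <- enum Z].
have os_uniq : uniq os by rewrite map_inj_uniq // enum_uniq.
have rs_root : all (root G) (pmap id os).
  apply/allP=> u; rewrite mem_pmap => /mapP[_ /mapP[l lZ ->] /esym/= ol].
  by rewrite mem_enum in lZ; have := oZ l lZ; rewrite ol.
have rs_uniq : uniq (pmap id os) by apply: (@pmap_uniq _ _ _ Some) => // -[].
have sizeZ : (#|Z| = size (pmap id os) + (None \in os))%N.
  rewrite size_pmap -count_uniq_mem // cardE -(size_map o) -/os.
  rewrite -(count_predC isSome); congr (_ + _)%N.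
  by apply: eq_count => -[].
have := max_poly_roots G0 rs_root rs_uniq.
rewrite sizeZ; case: (boolP (None \in os)) => [|_].
  case/mapP=> l lZ ol; rewrite mem_enum in lZ.
  have := oZ l lZ; rewrite -ol => /eqP top0 /leq_trans; rewrite addn1; apply.
  move: sizeG; rewrite leq_eqVlt ltnS => /predU1P[sz|//].
  by case/eqP: G0; apply/eqP; rewrite -lead_coef_eq0 /lead_coef sz top0.
by move=> lt; rewrite addn0 -ltnS; exact: leq_trans lt sizeG.
Qed.

(** * Evaluation codes *)

Definition pointmx (F : fieldType) (r n : nat) (P : 'I_n -> 'rV[F]_r) :
    'M[F]_(r, n) := \matrix_(j, i) P i 0 j.

Lemma evaluation_code_prodmx (F : finFieldType) (m n : nat)
    (P : 'I_n -> 'rV[F]_4) (c : 'I_n -> F) (w : 'rV[F]_n) :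
  (w \in evaluation_code m P c) = (w <= prodmx m c (pointmx P))%MS.
Proof.
apply/idP/sub_prodmxP => [/evaluation_codeP[f hf ->]|[a ->]].
  have [a ->] := homog_expand hf; exists a; apply/rowP=> i; rewrite !mxE.
  congr (_ * _); rewrite /form_eval meval_expand; apply: eq_bigr => g _.
  by congr (_ * _); apply: eq_bigr => k _; rewrite mxE.
apply/evaluation_codeP; exists (\sum_g a g *: \prod_k 'X_(g k)).
  apply: rpred_sum => g _; apply: rpredZ; rewrite mprodXE dhomogX; apply/eqP.
  rewrite [LHS]mdeg_sum; under eq_bigr do rewrite mdeg1.
  by rewrite sum1_card card_ord.
apply/rowP=> i; rewrite !mxE; congr (_ * _); rewrite /form_eval meval_expand.
by apply: eq_bigr => g _; congr (_ * _); apply: eq_bigr => k _; rewrite mxE.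
Qed.

Lemma prodmx_colscale (K : fieldType) (m r n : nat) (c d : 'I_n -> K)
    (A : 'M[K]_(r, n)) :
  prodmx m c (\matrix_(k, l) (d l * A k l)) =
  prodmx m (fun l => c l * d l ^+ m) A.
Proof.
apply/matrixP=> g l; rewrite !mxE -mulrA; congr (_ * _).
under eq_bigr do rewrite mxE.
by rewrite big_split prodr_const card_ord.
Qed.

Lemma min_dist_ge (F : finFieldType) (n d : nat) (C : {vspace 'rV[F]_n}) :
  (d <= n)%N ->
  (forall w, w \in C -> w != 0 -> (d + #|[set i | (w 0 i == 0)%R]| <= n)%N) ->
  (d <= min_dist C)%N.
Proof.
move=> dn wt; apply: (big_ind (fun x => d <= x)%N) => // [x y dx dy|u uC].
  by rewrite leq_min dx.
apply: (big_ind (fun x => d <= x)%N) => // [x y dx dy|v /andP[vC vu]].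
  by rewrite leq_min dx.
rewrite -(leq_add2r #|[set i | ((u - v) 0 i == 0)%R]|).
apply: (leq_trans (wt _ (rpredB uC vC) _)); first by rewrite subr_eq0 eq_sym.
rewrite /hamming_dist -[X in (X <= _)%N](card_ord n).
rewrite -(cardsC [set i | u 0 i != v 0 i]) leq_add2l subset_leq_card //.
by apply/subsetP=> i; rewrite !inE negbK !mxE subr_eq0.
Qed.

(** Here the matrix S expresses the coordinates of the points over K, up to a
    factor d on each point, as the four products of [segre]. *)
Section SegreCode.

Variables (F : finFieldType) (K : fieldType) (iota : {rmorphism F -> K}).
Variables (m q n : nat) (P : 'I_n -> 'rV[F]_4) (c : 'I_n -> F).
Variables (o : 'I_n -> option K) (d : 'I_n -> K) (S : 'M[K]_4).
Hypothesis (c_neq0 : forall i, c i != 0) (d_neq0 : forall i, d i != 0).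
Hypothesis (S_unit : S \in unitmx) (o_inj : injective o).
Hypothesis (m_lt_q : (m < q)%N) (n_large : (m * q.+1 < n)%N).
Hypothesis segreE :
  S *m map_mx iota (pointmx P) = \matrix_(k, l) (d l * segre q (o l) k).

Let e (l : 'I_n) : K := iota (c l) * d l ^+ m.

Let e_neq0 l : e l != 0.
Proof. by rewrite mulf_neq0 ?fmorph_eq0 ?expf_neq0. Qed.

(** The change of coordinates S does not affect the span of the products, and
    the factors d only change the weights, from c to e; so the code becomes,
    after extension of scalars, a space of bihomogeneous forms on the line. *)
Lemma code_bimonmx :
  (map_mx iota (prodmx m c (pointmx P)) :=: bimonmx m q e o)%MS.
Proof.
apply: eqmx_trans (prodmx_segre m q e o).
rewrite map_prodmx; apply/eqmxP.
have -> : prodmx m e (\matrix_(k, l) segre q (o l) k) =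
          prodmx m (iota \o c) (S *m map_mx iota (pointmx P)).
  rewrite segreE -[LHS](prodmx_colscale m (iota \o c) d).
  by congr prodmx; apply/matrixP=> k l; rewrite !mxE.
have full : (S *m map_mx iota (pointmx P) :=: map_mx iota (pointmx P))%MS.
  by apply: eqmxMfull; rewrite row_full_unit.
by rewrite !prodmxS ?full.
Qed.

Lemma dim_segre_code : \dim (evaluation_code m P c) = (m.+1 ^ 2)%N.
Proof.
rewrite (dimv_row_span (evaluation_code_prodmx m P c)) -(mxrank_map iota).
rewrite code_bimonmx; have /eqP-> : row_free (bimonmx m q e o).
  apply: inj_row_free => w w0; apply: contraTeq n_large => wN0.
  rewrite -leqNgt (leq_trans _ (bimonmx_zeros m_lt_q e_neq0 o_inj wN0)) //.
  rewrite -[X in (X <= _)%N]card_ord -cardsT subset_leq_card //.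
  by apply/subsetP=> l _; rewrite inE w0 mxE.
by rewrite card_prod card_ord.
Qed.

Lemma min_dist_segre_code :
  (n - m * q.+1 <= min_dist (evaluation_code m P c))%N.
Proof.
apply: min_dist_ge; first exact: leq_subr.
move=> w wC w0; suff zeros_w : (#|[set i | (w 0 i == 0)%R]| <= m * q.+1)%N.
  rewrite -[leqRHS](subnK (ltnW n_large)).
  by rewrite leq_add2l.
have /submxP[v def_w] : (map_mx iota w <= bimonmx m q e o)%MS.
  by rewrite -code_bimonmx map_submx -evaluation_code_prodmx.
have v0 : v != 0.
  apply: contra w0 => /eqP v0; rewrite -(map_mx_eq0 iota) def_w v0.
  by rewrite mul0mx.
rewrite (leq_trans _ (bimonmx_zeros m_lt_q e_neq0 o_inj v0)) //.
rewrite subset_leq_card //; apply/subsetP=> l; rewrite !inE -def_w mxE.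
by rewrite fmorph_eq0.
Qed.

End SegreCode.

(** * The codes of an elliptic quadric *)

Lemma row4_mx (K : fieldType) (t t' : K) :
  exists U : 'M[K]_4, forall v : 'rV_4, v *m U =
    row4 (v 0 0) (v 0 1 + t * v 0 2) (v 0 1 + t' * v 0 2) (v 0 3).
Proof.
exists (\matrix_i nth 0
  [:: row4 1 0 0 0; row4 0 1 1 0; row4 0 t t' 0; row4 0 0 0 1] i).
move=> v; rewrite mulmx_sum_row sum_ord4 !rowK /=.
by apply: row4P; rewrite !mxE /=; ring.
Qed.

(** With t and t^q the conjugate roots attached to the normal form, the point of
    affine coordinates (x, y) corresponds to u = x + t y in K: its coordinates
    z0, z1 + t z2, z1 + t^q z2, z3 are u u^q, u, u^q, 1, since
    x^2 + b x y + c y^2 = (x + t y) (x + t^q y) and since raising u to the power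
    q conjugates t. *)
Lemma elliptic_codeP (F : finFieldType) (K : closedFieldType)
    (iota : {rmorphism F -> K}) (Q : {mpoly F[4]}) (m n : nat)
    (P : 'I_n -> 'rV[F]_4) (c : 'I_n -> F) :
  elliptic_quadric iota Q -> rational_points Q P ->
  (forall i, c i != 0) -> (m < #|F|)%N ->
  [/\ n = (#|F| ^ 2 + 1)%N,
      \dim (evaluation_code m P c) = (m.+1 ^ 2)%N
    & (n - m * #|F|.+1 <= min_dist (evaluation_code m P c))%N].
Proof.
move=> Qell P_pts c0 lt_mq; set q := #|F| in lt_mq *.
have [homQ _ _] := Qell; have [A QA] := homog2_quadf homQ.
have [B [a [b [d [Bu a0 irr QB]]]]] := elliptic_normal_form QA Qell.
have [Pcone o_bij] := class_bijective P_pts Bu a0 irr QB.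
set o := fun i => _ in o_bij.
have nE : n = (q ^ 2 + 1)%N.
  rewrite -[LHS]card_ord (bij_eq_card o_bij) card_option card_prod -/q.
  by rewrite addn1.
have n_large : (m * q.+1 < n)%N.
  rewrite nE addn1 ltnS; case: (q) lt_mq => // q' lt_m; rewrite ltnS in lt_m.
  rewrite (leq_trans (leq_mul lt_m (leqnn _))) //; nia.
have [t [tq tr nt tF]] := conjugate_roots iota irr; rewrite -/q in tq tr nt.
have [U UE] := row4_mx t (t ^+ q).
have U_unit : U \in unitmx.
  rewrite -row_free_unit; apply: inj_row_free => v; rewrite UE => /rowP v0.
  have [e0 e1 e2 e3] := And4 (v0 0) (v0 1) (v0 2) (v0 3).
  rewrite !mxE /= in e0 e1 e2 e3.
  have v2 : v 0 2 = 0.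
    have : (t ^+ q - t) * v 0 2 = 0.
      transitivity ((v 0 1 + t ^+ q * v 0 2) - (v 0 1 + t * v 0 2)).
        by ring.
      by rewrite e1 e2 subrr.
    by move/eqP; rewrite mulf_eq0 subr_eq0 (negPf tq) => /eqP.
  by rewrite v2 mulr0 addr0 in e1; apply: row4P; rewrite ?mxE.
pose z i := P i *m invmx B.
pose oK i := omap (fun xy : F * F => iota xy.1 + t * iota xy.2) (o i).
have oK_inj : injective oK.
  suff inj : injective (omap (fun xy : F * F => iota xy.1 + t * iota xy.2)).
    by move=> i j /inj /(bij_inj o_bij).
  move=> [[x y]|] [[x' y']|] //= [xy].
  have [yy'|yy'] := eqVneq y y'.
    by rewrite yy' in xy *; move/addIr/fmorph_inj: xy => ->.
  have dy : iota (y - y') != 0 by rewrite fmorph_eq0 subr_eq0.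
  case/eqP: (tF ((x' - x) / (y - y'))); rewrite fmorph_div !rmorphB in dy *.
  apply: (mulIf dy); rewrite divfK //.
  transitivity (iota x + t * iota y - (iota x + t * iota y')); first by ring.
  by rewrite xy; ring.
have q_neq0 : (q == 0%N) = false by apply/eqP => q0; rewrite q0 in lt_mq.
pose e i := iota (cone_scale (z i)).
have e_neq0 i : e i != 0.
  rewrite fmorph_eq0 (cone_scale_neq0 irr (Pcone i)) //.
  rewrite mulmx_free_eq0; last by rewrite row_free_unit unitmx_inv.
  by have [/(_ i)[]] := P_pts.
pose S := (map_mx iota (invmx B) *m U)^T.
have S_unit : S \in unitmx.
  by rewrite unitmx_tr unitmx_mul U_unit andbT map_unitmx unitmx_inv.
have segreE :
    S *m map_mx iota (pointmx P) = \matrix_(k, l) (e l * segre q (oK l) k).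
  have zU l : map_mx iota (z l) *m U = \row_k (e l * segre q (oK l) k).
    have dz : z l = cone_scale (z l) *: cone_point b d (o l).
      by rewrite /o /z; apply: (cone_scaleK irr (Pcone l)).
    rewrite UE /e /oK; move: (cone_scale (z l)) dz => s ->.
    have frob x y : (iota x + t * iota y) ^+ q = iota x + t ^+ q * iota y.
      by rewrite (exprD_card iota) exprMn !fmorph_expr_card.
    case: (o l) => [[x y]|]; apply: row4P;
      rewrite !mxE /= /segre /= ?frob ?expr1n ?expr0n ?q_neq0
        ?(rmorphM, rmorphD, rmorph0, rmorph1, rmorphXn) /= -?tr -?nt; ring.
  apply/matrixP=> k l; transitivity ((map_mx iota (z l) *m U) 0 k).
    rewrite /z map_mxM -mulmxA /S; move: (_ *m U) => X; rewrite !mxE.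
    by apply: eq_bigr => j _; rewrite !mxE mulrC.
  by rewrite zU !mxE.
split=> //.
  exact: dim_segre_code c0 e_neq0 S_unit oK_inj lt_mq n_large segreE.
exact: min_dist_segre_code c0 e_neq0 S_unit oK_inj lt_mq n_large segreE.
Qed.

(** * The values of the bound *)

Lemma floor_2sqrt_ge (q k : nat) : (k%:Z <= floor_2sqrt q) = (k ^ 2 <= 4 * q)%N.
Proof.
have q0 : 0 <= q%:R :> algC by exact: ler0n.
rewrite real_floor_ge_int; last by rewrite realM ?realn ?sqrtC_real.
rewrite -(@ler_pXn2r _ 2) // ?nnegrE ?ler0n ?mulr_ge0 ?ler0n ?sqrtC_ge0 //.
by rewrite exprMn sqrtCK -!natrX -natrM ler_nat.
Qed.

Lemma floor_2sqrtE (q k : nat) :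
  (k ^ 2 <= 4 * q < k.+1 ^ 2)%N -> floor_2sqrt q = k%:Z.
Proof.
move=> /andP[]; rewrite ltnNge -!floor_2sqrt_ge -ltNge => *; lia.
Qed.

(** After squaring, the claim is 16 q <= (q + 1)^2, which holds from 14 on. *)
Lemma floor_2sqrt_le (q : nat) : (14 <= q)%N -> 4 * floor_2sqrt q <= 2 * q%:Z + 2.
Proof.
move=> q14; have : 0%:Z <= floor_2sqrt q by rewrite floor_2sqrt_ge.
case def_f : (floor_2sqrt q) => [k|//] _.
have := floor_2sqrt_ge q k; rewrite def_f lexx => /esym; nia.
Qed.

Lemma finField_card_prime (F : finFieldType) (r s : nat) :
  prime r -> prime s -> (r %| #|F|)%N -> (s %| #|F|)%N -> r = s.
Proof.
move=> pr ps rF sF; have [p _ pF] := finField_card_pnat F.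
have := pnat_dvd rF pF; have := pnat_dvd sF pF; rewrite !pnatE //.
by move=> /eqP-> /eqP.
Qed.

Lemma delta_le (q : nat) : delta q <= q%:Z ^+ 2 + 1 - (3 * q%:Z + 3).
Proof. by rewrite /delta lerD2l lerN2 le_max lexx. Qed.

(** The formulas of the next two lemmas fail at q = 6 and at q = 12; they hold
    for cardinals of fields because these are prime powers. *)
Lemma delta_small (F : finFieldType) :
  (5 <= #|F| <= 7)%N -> delta #|F| = #|F|%:Z ^+ 2 + 1 - 4 * #|F|%:Z.
Proof.
move=> q57; have : #|F| \in iota 5 3 by rewrite mem_iota.
rewrite !inE => /or3P[] /eqP qE.
- by rewrite qE /delta (@floor_2sqrtE 5 4).
- by have := @finField_card_prime F 2 3; rewrite qE => /(_ isT isT isT isT).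
- by rewrite qE /delta (@floor_2sqrtE 7 5).
Qed.

Lemma delta_medium (F : finFieldType) :
  (8 <= #|F| <= 13)%N ->
  delta #|F| = #|F|%:Z ^+ 2 - #|F|%:Z - 4 * floor_2sqrt #|F|.
Proof.
move=> q813; have : #|F| \in iota 8 6 by rewrite mem_iota.
rewrite !inE => /or4P[/eqP qE|/eqP qE|/eqP qE|/or3P[] /eqP qE].
- by rewrite qE /delta (@floor_2sqrtE 8 5).
- by rewrite qE /delta (@floor_2sqrtE 9 6).
- by have := @finField_card_prime F 2 5; rewrite qE => /(_ isT isT isT isT).
- by rewrite qE /delta (@floor_2sqrtE 11 6).
- by have := @finField_card_prime F 2 3; rewrite qE => /(_ isT isT isT isT).
- by rewrite qE /delta (@floor_2sqrtE 13 7).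
Qed.

Lemma delta_large (q : nat) :
  (16 <= q)%N -> delta q = q%:Z ^+ 2 - 2 - 3 * q%:Z.
Proof.
move=> q16; have le_f : 4 * floor_2sqrt q <= 2 * q%:Z + 2.
  by apply: floor_2sqrt_le; lia.
rewrite /delta max_l; first by ring.
rewrite ge_min; apply/orP; right; lia.
Qed.

Theorem theorem2p8 (q : nat) (q_ge5 : (5 <= q)%N)
    (F : finFieldType) (card_F : #|F| = q)
    (K : closedFieldType) (iota : {rmorphism F -> K})
    (iota_alg : integralRange iota)
    (Q : {mpoly F[4]}) (Q_elliptic : elliptic_quadric iota Q)
    (n : nat) (P : 'I_n -> 'rV[F]_4) (P_points : rational_points Q P)
    (c : 'I_n -> F) (c_neq0 : forall i, c i != 0) :
  let C := evaluation_code 3 P c in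
  [/\ n = (q ^ 2 + 1)%N,
      \dim C = 16%N,
      delta q <= (min_dist C)%:Z
    & [/\ (q <= 7)%N -> delta q = q%:Z ^+ 2 + 1 - 4 * q%:Z,
          (8 <= q <= 13)%N ->
            delta q = q%:Z ^+ 2 - q%:Z - 4 * floor_2sqrt q
        & (16 <= q)%N -> delta q = q%:Z ^+ 2 - 2 - 3 * q%:Z]].
Proof.
move=> C; subst q.
have [nE dimC distC] := elliptic_codeP Q_elliptic P_points c_neq0 (ltnW q_ge5).
split=> //.
  apply: (le_trans (delta_le _)); move: (min_dist C) distC => d.
  by rewrite nE; lia.
split=> [q_le7|q_8_13|]; last exact: delta_large.
  by apply: delta_small; rewrite q_ge5.
exact: delta_medium.
Qed.
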